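(* For every integer $n\ge 0$, $\overline{p}_3(8n+7)\equiv 0 \pmod{64}$.
   Context: An overpartition of $n$ is a partition of $n$ in which the first occurrence of each distinct part may (or may not) be overlined. An overpartition triple of $n$ is a triple of overpartitions whose parts together sum to $n$. $\overline{p}_3(n)$ denotes the number of overpartition triples of $n$, with $\overline{p}_3(0)=1$; equivalently $\sum_{n\ge0}\overline{p}_3(n)q^n=\big((-q;q)_\infty/(q;q)_\infty\big)^3$, where $(a;q)_\infty=\prod_{n\ge0}(1-aq^n)$. *)

(* Defs.v *)
From mathcomp Require Import all_boot.

Set Implicit Arguments.
Unset Strict Implicit.
Unset Printing Implicit Defensive.

(* An entry (k, b) is a part of size k, overlined iff b is true. *)
Definition parts := seq (nat * bool).

Definition weight (s : parts) : nat := \sum_(x <- s) x.1.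

(* The parts are listed in weakly decreasing order, so an overlined part is the
   first occurrence of its size iff it differs from the part just before it. *)
Definition overpartition (s : parts) : bool :=
  all (fun x => 0 < x.1) s &&
  sorted (fun x y => (y.1 <= x.1) && (y.2 ==> (y.1 != x.1))) s.

Definition overpartition_triple (n : nat) (s1 s2 s3 : parts) : bool :=
  [&& overpartition s1, overpartition s2, overpartition s3
    & weight s1 + weight s2 + weight s3 == n].

(* Lists of at most n parts, each of size at most n: a finite type which, by
   bparts_complete below, contains every component of an overpartition triple
   of n. *)
Definition bparts (n : nat) : finType := {bseq n of 'I_n.+1 * bool}.

Definition parts_of (n : nat) (u : bparts n) : parts :=
  [seq (val x.1, x.2) | x <- (u : {bseq n of 'I_n.+1 * bool})].

Definition p3bar (n : nat) : nat :=
  #|[set t : bparts n * bparts n * bparts n |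
      overpartition_triple n (parts_of t.1.1) (parts_of t.1.2) (parts_of t.2)]|.

Lemma parts_of_inj n : injective (@parts_of n).
Proof.
move=> u v /inj_map-E; apply/val_inj/E => -[i b] [j c] [/val_inj-> ->] //.
Qed.

Lemma bparts_complete n (s : parts) :
  overpartition s -> weight s <= n -> exists u : bparts n, parts_of u = s.
Proof.
move=> /andP[pos _] le_sn.
have le_size : size s <= n.
  apply: leq_trans le_sn; rewrite /weight.
  elim: s pos => [|x s IHs] //= /andP[x_gt0 /IHs le_s].
  by rewrite big_cons -add1n leq_add.
have le_part x : x \in s -> x.1 <= n.
  by move=> sx; apply: leq_trans le_sn; rewrite /weight (big_rem x) //= leq_addr.
pose f (x : nat * bool) : 'I_n.+1 * bool := (inord x.1, x.2).
have size_f : size (map f s) <= n by rewrite size_map.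
exists (Bseq size_f : {bseq n of 'I_n.+1 * bool}).
rewrite /parts_of /= -map_comp -[RHS]map_id; apply/eq_in_map => -[k b] /le_part /= le_kn.
by rewrite inordK.
Qed.

(* Main.v *)
Require Import Defs.
From mathcomp Require Import all_boot.
From mathcomp Require Import all_algebra ring zify.

(* Write G for the generating function of overpartitions. By Gauss' identity
   prod (1 - q^k) / (1 + q^k) = sum_(k in Z) (-1)^k q^(k^2), we have
   G * (1 + 2 S) = 1 with S = sum_(k >= 1) (-1)^k q^(k^2), so modulo 64
     G^3 = 1 - 6 S + 24 S^2 - 80 S^3 + 240 S^4 - 672 S^5.
   Split S = a + b into its odd and even exponents: those of a are 1 mod 8 and
   those of b are 0 mod 4. A monomial a^i b^j can only have a nonzero coefficient
   at q^(8n+7) if i = 3 (mod 4), and a^3 itself has none; the remaining terms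
   are 240 * 4 a^3 b and - 672 * 10 a^3 b^2, both divisible by 64. *)

Set Implicit Arguments.
Unset Strict Implicit.
Unset Printing Implicit Defensive.
Import GRing.Theory.
Local Open Scope ring_scope.

(* A finite form of Gauss' identity in the style of Shanks: the extra sum on the
   right is divisible by [q ^+ n.+1]. *)
Lemma gauss_square_sum (R : comNzRingType) (q : R) (n : nat) :
  (1 + 2 * \sum_(0 <= i < n) (-1) ^+ i.+1 * q ^+ (i.+1 ^ 2)%N) *
    \prod_(0 <= k < n) (1 + q ^+ k.+1) =
  \prod_(0 <= k < n) (1 - q ^+ k.+1) +
  2 * \sum_(0 <= i < n) (-1) ^+ i.+1 * q ^+ (i.+1 * n.+1)%N *
        (\prod_(i.+1 <= k < n) (1 - q ^+ k.+1) *
         \prod_(0 <= k < i) (1 + q ^+ k.+1)).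
Proof.
elim: n => [|n IHn]; first by rewrite !big_geq // !mulr0 addr0 mulr1.
(* Induct on n: the two extra sums differ by a telescoping sum of [V]. *)
pose V i := (-1) ^+ i.+1 * q ^+ (i.+1 * n.+1)%N *
        (\prod_(i <= k < n) (1 - q ^+ k.+1) *
         \prod_(0 <= k < i) (1 + q ^+ k.+1)).
have step i : (0 <= i < n)%N ->
    (-1) ^+ i.+1 * q ^+ (i.+1 * n.+2)%N *
      (\prod_(i.+1 <= k < n.+1) (1 - q ^+ k.+1) *
       \prod_(0 <= k < i) (1 + q ^+ k.+1)) =
    (1 + q ^+ n.+1) * ((-1) ^+ i.+1 * q ^+ (i.+1 * n.+1)%N *
      (\prod_(i.+1 <= k < n) (1 - q ^+ k.+1) *
       \prod_(0 <= k < i) (1 + q ^+ k.+1))) + (V i.+1 - V i).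
  move=> /andP[_ lt_in]; rewrite /V.
  rewrite [\prod_(i.+1 <= k < n.+1) _]big_nat_recr //=.
  rewrite [\prod_(i <= k < n) _]big_ltn //.
  rewrite [\prod_(0 <= k < i.+1) _]big_nat_recr //=.
  rewrite (mulnS i.+1 n.+1) (mulSn i.+1 n.+1) !exprD.
  rewrite ![(-1) ^+ _.+1]exprS.
  move: (\prod_(_ <= k < _) _) (\prod_(_ <= k < _) _) => a b.
  move: (q ^+ (_ * _)) ((-1) ^+ _) => c d.
  move: (q ^+ i.+1) (q ^+ n.+1) => u v; ring.
rewrite [\sum_(0 <= i < n.+1) _ * _ * (_ * _)]big_nat_recr //=.
rewrite (eq_big_nat _ _ step) big_split /=.
rewrite -mulr_sumr telescope_sumr // [V 0]/V [V n]/V.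
rewrite ![\prod_(n <= k < n) _]big_geq // [\prod_(n.+1 <= k < n.+1) _]big_geq //.
rewrite [\prod_(0 <= k < 0) _]big_geq // !(big_nat_recr n) //=.
have -> : (n.+1 * n.+2 = n.+1 + n.+1 ^ 2)%N by rewrite mulnS mulnn.
rewrite exprD [(1 * n.+1)%N]mul1n [(-1) ^+ 1]expr1; move: IHn.
move: (q ^+ (_ ^ 2)) ((-1) ^+ n.+1) (q ^+ n.+1) => c d u.
move: (\prod_(0 <= k < n) (1 - _)) (\prod_(0 <= k < n) _) => a b.
move: (\sum_(_ <= k < _) _ * _ * _) (\sum_(_ <= k < _) _) => s t IH.
transitivity ((1 + 2 * t) * b * (1 + u) + 2 * d * c * b * (1 + u)).
  by ring.
by rewrite IH; ring.
Qed.

(** * Polynomials modulo a power of ['X] *)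

Lemma inverse_mod_Xn (R : comNzRingType) (p : {poly R}) (k : nat) :
  p`_0 = 1 -> exists p' r, p * p' = 1 + r * 'X^k.
Proof.
move=> p0; have [t ->] : exists t, p = 1 - t * 'X.
  exists (- drop_poly 1 p); rewrite -[LHS](poly_take_drop 1) mulNr opprK expr1.
  by congr (_ + _); apply/polyP => -[|i]; rewrite coef_take_poly coef1.
(* The truncated geometric series in [t * 'X], whose error is its first omitted term. *)
exists (\sum_(i < k) (t * 'X) ^+ i), (- t ^+ k).
have := subrX1 (t * 'X) k; rewrite exprMn => H.
by rewrite mulNr -[1 - _ in LHS]opprB mulNr -H opprB.
Qed.

Lemma eq_mod_Xn (R : nzRingType) (p q : {poly R}) (k : nat) :
  (forall i, (i < k)%N -> p`_i = q`_i) -> exists r, p = q + r * 'X^k.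
Proof.
move=> e; exists (drop_poly k (p - q)).
have -> : drop_poly k (p - q) * 'X^k = p - q.
  rewrite -[RHS](poly_take_drop k) -[LHS]add0r; congr (_ + _).
  apply/polyP => i; rewrite coef0 coef_take_poly.
  by case: ifP => // /e; rewrite coefB => ->; rewrite subrr.
by rewrite addrC subrK.
Qed.

(** * Polynomials with exponents in one residue class *)

Definition graded (d r : nat) (p : {poly int}) :=
  forall i, p`_i != 0 -> i = r %[mod d].

Lemma gradedXn d r k : k = r %[mod d] -> graded d r 'X^k.
Proof. by move=> e i; rewrite coefXn; case: (i =P k) => [->|]. Qed.

Lemma gradedD d r p q : graded d r p -> graded d r q -> graded d r (p + q).
Proof.
move=> Hp Hq i; rewrite coefD => nz.
have [p0|/Hp//] := eqVneq p`_i 0.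
by apply: Hq; apply: contraNneq nz => q0; rewrite p0 q0.
Qed.

Lemma gradedM d r s p q :
  graded d r p -> graded d s q -> graded d (r + s) (p * q).
Proof.
move=> Hp Hq i nz; apply/eqP; apply: contraNT nz => ne.
rewrite coefM big1 // => j _; apply/eqP; rewrite mulf_eq0.
rewrite -[_ == 0 as X in X || _]negbK -[_ == 0 as X in _ || X]negbK -negb_and.
apply: contra ne => /andP[/Hp ej /Hq ek].
by rewrite -(subnKC (leq_ord j)) -modnDm ej ek modnDm.
Qed.

Lemma gradedC d (c : int) : graded d 0 c%:P.
Proof. by case=> [|i]; rewrite coefC. Qed.

Lemma graded_sum d r (I : Type) (s : seq I) (P : pred I) (F : I -> {poly int}) :
  (forall i, P i -> graded d r (F i)) -> graded d r (\sum_(i <- s | P i) F i).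
Proof.
move=> H; apply: (big_ind (graded d r)) => //; last exact: gradedD.
by move=> i; rewrite coef0 eqxx.
Qed.

Lemma graded_coef d r p i :
  graded d r p -> (i %% d != r %% d)%N -> p`_i = 0.
Proof. by move=> H ne; apply/eqP; apply: contraNT ne => /H ->. Qed.

Lemma graded_signXn d r (e k : nat) :
  k = r %[mod d] -> graded d r ((-1) ^+ e * 'X^k).
Proof.
move=> ek i; rewrite -signr_odd mulr_sign.
by case: (odd e); rewrite ?coefN coefXn; case: (i =P k) => [->|].
Qed.

Lemma gradedX d r p k : graded d r p -> graded d (k * r) (p ^+ k).
Proof.
move=> H; elim: k => [|k IHk]; first exact: (@gradedXn d 0 0).
by rewrite exprS mulSn; apply: gradedM.
Qed.

Lemma gradedN d r p : graded d r p -> graded d r (- p).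
Proof. by move=> H i; rewrite coefN oppr_eq0; apply: H. Qed.

Lemma graded_nat d (k : nat) : graded d 0 k%:R.
Proof. by rewrite -polyC_natr; apply: gradedC. Qed.

(** * Counting overpartitions with a bounded first part *)

Definition part_rel (x y : nat * bool) : bool :=
  (y.1 <= x.1)%N && (y.2 ==> (y.1 != x.1)).

(* The parts that may follow an entry [(m, _)] in an overpartition. *)
Definition follows (m : nat) (s : parts) : bool :=
  all (fun x => 0 < x.1)%N s && path part_rel (m, false) s.

Lemma follows_overpartition m s : follows m s -> overpartition s.
Proof. by case/andP=> pos /path_sorted srt; apply/andP. Qed.

Lemma weight_cons x s : weight (x :: s) = (x.1 + weight s)%N.
Proof. by rewrite /weight big_cons. Qed.

(** The strict bound matters: a first part of size [m] could be overlined, which [follows m]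
    forbids. *)
Lemma overpartition_follows m s :
  overpartition s -> (weight s < m)%N -> follows m s.
Proof.
case/andP=> pos srt lt_sm; apply/andP; split=> //.
case: s srt lt_sm {pos} => [|[k b] s] //= -> lt_sm; rewrite andbT /part_rel /=.
by rewrite weight_cons /= in lt_sm; case: b; rewrite /=; lia.
Qed.

Lemma follows_cons m k b s :
  follows m ((k, b) :: s) =
    [&& 0 < k <= m, b ==> (k != m) & follows k s]%N.
Proof.
(* [part_rel] ignores the overline of its first argument. *)
rewrite /follows /=; have -> : path part_rel (k, b) s = path part_rel (k, false) s.
  by case: s.
rewrite /part_rel /=.
by case: (0 < k)%N; case: (k <= m)%N; case: (b ==> _); case: all.
Qed.

Definition starts (x : nat * bool) (P : pred parts) (s : parts) : bool :=
  if s is y :: s' then (y == x) && P s' else false.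

(* An overlined first part of size [m.+1] is excluded by [follows], so the list
   starts with a plain [m.+1], or starts with an overlined [m], or follows [m]. *)
Lemma follows_split m j n s :
  (follows m.+1 s && (weight s + j == n) =
   starts (m.+1, false) (fun t => follows m.+1 t && (weight t + (m.+1 + j) == n)) s
   + (follows m s && (weight s + j == n))
   + starts (m, true)
       (fun t => [&& 0 < m, follows m t & weight t + (m + j) == n]) s :> nat)%N.
Proof.
case: s => [|[k b] s]; first by rewrite /starts /follows /= add0n addn0.
rewrite /starts !follows_cons weight_cons /= !xpair_eqE.
rewrite (addnC k) -!addnA.
have [->|ne1] := eqVneq k m.+1.
  rewrite leqnn ltnn (gtn_eqF (ltnSn m)) !andbF /= !addn0.
  by case: b.
have [->|ne2] := eqVneq k m.
  rewrite leqnn leqnSn /= eqb_id implybF !andbT.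
  by case: b => //=; rewrite ?addn0 ?andbF ?implybT //= andbA.
by rewrite !implybT /= addn0 [(k <= m.+1)%N]leq_eqVlt (negPf ne1) ltnS.
Qed.

(** Prepending [x] is a bijection between the two sets counted. The hypothesis ensures, through
    [bparts_complete], that the longer list still lies in [bparts N]. *)
Lemma count_starts N (x : nat * bool) (P : pred parts) :
  (forall s, P s -> overpartition (x :: s) && (weight (x :: s) <= N)%N) ->
  (\sum_(u : bparts N) starts x P (parts_of u) =
   \sum_(u : bparts N) P (parts_of u))%N.
Proof.
move=> PN.
have repr_cons s : P s -> exists u : bparts N, parts_of u = x :: s.
  by move=> /PN/andP[]; apply: bparts_complete.
have repr s : P s -> exists u : bparts N, parts_of u = s.
  move=> /PN/andP[/andP[/= /andP[_ pos] /path_sorted srt]].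
  rewrite weight_cons => le_N; apply: bparts_complete; last by lia.
  by apply/andP.
have sum_card (Q : pred parts) :
    (\sum_(u : bparts N) Q (parts_of u) = #|[set u : bparts N | Q (parts_of u)]|)%N.
  by rewrite -sum1dep_card [RHS]big_mkcond; apply: eq_bigr => u _; case: Q.
rewrite !sum_card.
(* By [repr_cons], the default [u] is never taken when [P] holds. *)
pose F (u : bparts N) : bparts N :=
  odflt u [pick v : bparts N | parts_of v == x :: parts_of u].
have FE u : P (parts_of u) -> parts_of (F u) = x :: parts_of u.
  rewrite /F => /repr_cons[v0 Hv0]; case: pickP => [v /eqP //|/(_ v0)].
  by rewrite Hv0 eqxx.
rewrite -(card_in_imset (f := F) (D := [set u | P (parts_of u)])); last first.
  move=> u v; rewrite !inE => Pu Pv eF; apply: parts_of_inj.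
  by have := FE u Pu; rewrite eF FE // => -[].
congr (#|pred_of_set _|); apply/setP => v; rewrite inE.
apply/idP/imsetP => [|[u]]; last by rewrite inE => Pu ->; rewrite FE //= eqxx.
case E: (parts_of v) => [|y s] //= /andP[/eqP ey Ps].
have [u Hu] := repr s Ps; exists u; first by rewrite inE Hu.
by apply: parts_of_inj; rewrite FE Hu // E ey.
Qed.

(** Since [bparts N] is finite, this is a polynomial; only its coefficients up to degree [N] are
    sure to count all lists, so the identities below hold modulo ['X^(N.+1)]. *)
Definition follows_gf (N m : nat) : {poly int} :=
  \sum_(u : bparts N | follows m (parts_of u)) 'X^(weight (parts_of u)).

Lemma coef_follows_gf N m j n :
  (follows_gf N m * 'X^j)`_n =
  (\sum_(u : bparts N)
     (follows m (parts_of u) && (weight (parts_of u) + j == n)))%N%:R.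
Proof.
rewrite mulr_suml coef_sum big_mkcond natr_sum; apply: eq_bigr => u _.
by rewrite -exprD coefXn eq_sym; case: follows.
Qed.

(** This is [follows_split] read on coefficients: a leading plain [m.+1] gives the term moved to the
    left, and a leading overlined [m], possible only for [m > 0], gives ['X^m]. *)
Lemma follows_gfS N m : exists r : {poly int},
  follows_gf N m.+1 * (1 - 'X^(m.+1)) =
  follows_gf N m * (1 + 'X^m *+ (0 < m)%N) + r * 'X^(N.+1).
Proof.
apply: eq_mod_Xn => n; rewrite ltnS => le_nN.
have coef_gf k : (follows_gf N k)`_n =
    (\sum_(u : bparts N)
       (follows k (parts_of u) && (weight (parts_of u) + 0 == n)))%N%:R.
  by rewrite -coef_follows_gf expr0 mulr1.
rewrite mulrBr mulrDr mulrnAr !mulr1 coefB coefD coefMn !coef_gf !coef_follows_gf.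
apply/eqP; rewrite subr_eq -mulrnA -!natrD; apply/eqP; congr (_%:R).
under eq_bigr do rewrite follows_split addn0.
rewrite !big_split /= !count_starts ?addn0.
- rewrite addnAC addnC addnA [RHS]addnAC; congr (_ + _ + _)%N.
  rewrite big_distrl /=; apply: eq_bigr => u _.
  by case: (0 < m)%N; rewrite ?muln1 ?muln0.
- move=> s /and3P[m_gt0 fs /eqP w].
  rewrite weight_cons /=; apply/andP; split; last by lia.
  apply: (@follows_overpartition m.+1); rewrite follows_cons fs m_gt0 leqnSn /=; lia.
- move=> s /andP[fs /eqP w].
  rewrite weight_cons /=; apply/andP; split; last by lia.
  by apply: (@follows_overpartition m.+1); rewrite follows_cons fs leqnn.
Qed.

Lemma follows_gf0 N : follows_gf N 0 = 1.
Proof.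
have [u0 Hu0] : exists u : bparts N, parts_of u = [::].
  by apply: bparts_complete; rewrite // /weight big_nil.
rewrite /follows_gf (big_pred1 u0) ?Hu0 /weight ?big_nil // => u.
apply/idP/eqP => [|->]; last by rewrite Hu0.
case E: (parts_of u) => [|[k b] s]; last first.
  by rewrite follows_cons leqn0; case: k {E}.
by move=> _; apply: parts_of_inj; rewrite E Hu0.
Qed.

(** Iterating [follows_gfS] adds one factor to each product. The right product stops at exponent
    [m.-1] because a part of size [m] may not be overlined here. *)
Lemma follows_gf_prod N m : exists r : {poly int},
  follows_gf N m * \prod_(0 <= k < m) (1 - 'X^(k.+1)) =
  \prod_(0 <= k < m.-1) (1 + 'X^(k.+1)) + r * 'X^(N.+1).
Proof.
elim: m => [|m [r IH]].
  by exists 0; rewrite !big_geq // follows_gf0 mulr1 mul0r addr0.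
have [r' Hr'] := follows_gfS N m.
rewrite big_nat_recr //= mulrA mulrAC Hr' mulrDl mulrAC {}IH.
case: m r' {Hr'} => [|m] r' /=.
  by rewrite !big_geq //; exists (r + r'); rewrite mulr0n; ring.
exists (r * (1 + 'X^(m.+1)) + r' * \prod_(0 <= k < m.+1) (1 - 'X^(k.+1))).
by rewrite [\prod_(0 <= k < m.+1) (1 + 'X^_)]big_nat_recr //= mulr1n; ring.
Qed.

(** With the bound [N.+1], every overpartition of weight at most [N] satisfies [follows], so the
    cube counts all triples. *)
Lemma p3bar_coef N : ((p3bar N)%:R : int) = (follows_gf N N.+1 ^+ 3)`_N.
Proof.
rewrite 2!exprSr expr1 /follows_gf.
rewrite big_distrlr pair_big big_distrlr pair_big /= coef_sum.
rewrite /p3bar -sum1dep_card natr_sum.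
rewrite big_mkcond [RHS]big_mkcond; apply: eq_bigr => -[[u v] w] _ /=.
rewrite -!exprD coefXn /overpartition_triple [_ == N]eq_sym.
case: eqP => [eN|]; last by rewrite !andbF; case: ifP.
have E s : (weight s <= N)%N -> follows N.+1 s = overpartition s.
  move=> le_sN; apply/idP/idP => [|/overpartition_follows-> //].
  exact: follows_overpartition.
rewrite !E ?andbT -?andbA; by [|lia].
Qed.

(** * The generating function as an inverse of the series of squares *)

Definition square_series (N : nat) : {poly int} :=
  \sum_(0 <= i < N) (-1) ^+ i.+1 * 'X^(i.+1 ^ 2)%N.

(** Modulo [Y], the product formula reads [G * A = B] and Gauss' identity reads
    [(1 + 2 * S) * B = A]. Hence [G * (1 + 2 * S) * B = B], and [B] cancels because its constant
    term is 1. *)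
Lemma follows_gf_inverse N : exists r : {poly int},
  follows_gf N N.+1 * (1 + 2 * square_series N) = 1 + r * 'X^(N.+1).
Proof.
have [r1] := follows_gf_prod N N.+1; rewrite big_nat_recr //=.
have := gauss_square_sum ('X : {poly int}) N; rewrite -/(square_series N).
set A := \prod_(0 <= k < N) (1 - _); set B := \prod_(0 <= k < N) (1 + _).
set Y := 'X^(N.+1); set T := \sum_(0 <= i < N) _.
have [t ->] : exists t, T = t * Y.
  exists (\sum_(0 <= i < N) (-1) ^+ i.+1 * 'X^(i * N.+1) *
    (\prod_(i.+1 <= k < N) (1 - 'X^(k.+1)) * \prod_(0 <= k < i) (1 + 'X^(k.+1)))).
  rewrite mulr_suml; apply: eq_bigr => i _.
  by rewrite mulSn exprD -/Y; ring.
have B0 : B`_0 = 1.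
  rewrite /B coef0_prod big1 // => i _.
  by rewrite coefD coef1 coefXn addr0.
have [B' [s BB']] := inverse_mod_Xn N.+1 B0; rewrite -/Y in BB'.
set G := follows_gf N N.+1; set S := square_series N => HS HG.
exists (B' * (G * A + 2 * G * t + r1) - s * G * (1 + 2 * S) + s).
have E1 : G * A * (1 - Y) = B + r1 * Y by rewrite -HG; ring.
have E2 : A = (1 + 2 * S) * B - 2 * (t * Y) by rewrite HS; ring.
have : G * (1 + 2 * S) * (B * B') =
   B' * (G * A * (1 - Y)) + B' * (G * A + 2 * G * t) * Y.
  by rewrite [in RHS]E2; ring.
rewrite E1 BB' => H.
have -> : G * (1 + 2 * S) =
  G * (1 + 2 * S) * (1 + s * Y) - s * G * (1 + 2 * S) * Y by ring.
rewrite H; have -> : B' * (B + r1 * Y) = B * B' + B' * r1 * Y by ring.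
by rewrite BB'; ring.
Qed.

(** * The coefficient at [8 * n + 7] modulo 64 *)

Lemma square_series_split N : exists a b : {poly int},
  [/\ square_series N = a + b, graded 8 1 a & graded 4 0 b].
Proof.
exists (\sum_(0 <= i < N | ~~ odd i) (-1) ^+ i.+1 * 'X^(i.+1 ^ 2)%N),
  (\sum_(0 <= i < N | odd i) (-1) ^+ i.+1 * 'X^(i.+1 ^ 2)%N); split.
- by rewrite /square_series (bigID odd) addrC.
(* With [i = 2h] the root is [2h + 1], whose square is [4h(h + 1) + 1], and [h(h + 1)] is even. *)
- apply: graded_sum => i /even_halfK <-; apply: graded_signXn; rewrite -mulnn.
  have : ~~ odd (i./2 * i./2.+1)%N by rewrite oddM /= andbN.
  by move/even_halfK; lia.
- apply: graded_sum => i od; apply: graded_signXn; rewrite -mulnn.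
  have -> : i = (i./2.*2.+1)%N by rewrite odd_halfK // prednK ?odd_gt0.
  lia.
Qed.

Lemma p3bar_8n7 (n : nat) : exists c : int, (p3bar (8 * n + 7))%:R = c *+ 64.
Proof.
set N := (8 * n + 7)%N; set G := follows_gf N N.+1.
have [r HG] := follows_gf_inverse N.
have [a [b [HS ga gb]]] := square_series_split N.
rewrite HS -/G in HG.
have ga4 : graded 4 1 a by move=> i /ga; lia.
(* Each [f] with index [j] is the cofactor of [a ^+ j] in the quintic [Q] below, taken at
   [a + b]. *)
pose f0 := 1 - 6 * b + 24 * b ^+ 2 - 80 * b ^+ 3 + 240 * b ^+ 4 - 672 * b ^+ 5.
pose f1 := - 6 + 48 * b - 240 * b ^+ 2 + 960 * b ^+ 3 - 3360 * b ^+ 4.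
pose f2 := 24 - 240 * b + 1440 * b ^+ 2 - 6720 * b ^+ 3.
pose f4 := 240 - 3360 * b.
have [s [t Hs]] : exists s t : {poly int}, G ^+ 3 =
    f0 + a * f1 + a ^+ 2 * f2 + a ^+ 3 * - 80%:R + a ^+ 4 * f4
    + a ^+ 5 * - 672%:R + s *+ 64 + t * 'X^(N.+1).
  pose x := a + b; set Y := 'X^(N.+1) in HG *.
  pose Q := 1 - 6 * x + 24 * x ^+ 2 - 80 * x ^+ 3 + 240 * x ^+ 4 - 672 * x ^+ 5.
  (* [Q] truncates the series of [(1 + 2 * x) ^- 3], and [rho] measures the error exactly:
     [Q * (1 + 2 * x) ^+ 3 = 1 - 64 * rho]. *)
  pose rho := 28 * x ^+ 6 + 96 * x ^+ 7 + 84 * x ^+ 8.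
  (* Here 15 and 105 are 960 / 64 and 6720 / 64, from the mixed terms in [a ^+ 3]; the second
     witness comes from expanding [(1 + r * Y) ^+ 3]. *)
  exists (a ^+ 3 * (15 * b - 105 * b ^+ 2) + rho * G ^+ 3),
    (Q * (3 * r + 3 * r ^+ 2 * Y + r ^+ 3 * Y ^+ 2)).
  transitivity (Q * (G * (1 + 2 * x)) ^+ 3 + 64 * (rho * G ^+ 3)).
    by rewrite /Q /rho; ring.
  by rewrite HG /Q /rho /x /f0 /f1 /f2 /f4; ring.
have coef_agf d k f : graded d k a -> graded d 0 f -> forall m,
    (N %% d != (m * k + 0) %% d)%N -> (a ^+ m * f)`_N = 0.
  by move=> gr gf m; apply: graded_coef; apply: gradedM => //; apply: gradedX.
have graded_f : [/\ graded 4 0 f0, graded 4 0 f1, graded 4 0 f2 & graded 4 0 f4].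
  split; repeat first [exact: gb | exact: graded_nat | exact: (@gradedXn 4 0 0)
    | exact: (gradedX _ gb)
    | apply: gradedD | apply: gradedN | apply: (@gradedM 4 0 0)].
case: graded_f => g0 g1 g2 g4; clearbody f0 f1 f2 f4.
exists s`_N.
rewrite -coefMn p3bar_coef -/G Hs; set c := s *+ 64.
rewrite !coefD coefMXn ltnSn addr0.
(* The pure cube needs modulus 8: its exponents are 3 modulo 8, whereas [N] is 7. Modulus 4 excludes
   the other terms, as [N] is 3 modulo 4. *)
have c80 : graded 8 0 (- 80%:R) by apply: gradedN; apply: graded_nat.
have c672 : graded 4 0 (- 672%:R) by apply: gradedN; apply: graded_nat.
rewrite (graded_coef g0) ?(coef_agf _ _ _ ga4 g1 1%N) ?(coef_agf _ _ _ ga4 g2)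
  ?(coef_agf _ _ _ ga c80) ?(coef_agf _ _ _ ga4 g4)
  ?(coef_agf _ _ _ ga4 c672) ?add0r //; by rewrite /N; lia.
Qed.

Local Close Scope ring_scope.

Theorem theorem2p9 (n : nat) : p3bar (8 * n + 7) = 0 %[mod 64].
Proof. by have [c] := p3bar_8n7 n; rewrite natz; lia. Qed.
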